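(* Fix $\varepsilon\in(0,1/2)$ and let $c,\mu,L,M>0$ and an integer $n_0$ be constants, depending only on $\varepsilon$, with the following property: (P) whenever $(n,p,G,\beta,H,\Gamma)$ is an eligible tuple (with respect to $\varepsilon,c,\mu,M,n_0$), there is an $L/(pn)$-spread probability measure on the family of $\Gamma$-conflict-free Hamilton cycles of $H$. (Such constants exist for every $\varepsilon\in(0,1/2)$.) Then there exist $D=D(L)>0$ and a deterministic sequence $\xi_n\to0$ such that for all sufficiently large $n$, every eligible tuple $(n,p,G,\beta,H,\Gamma)$ and every $t$ with $D\log n/(pn)\le t\le1$ satisfy $$\mathbb P[H_t\text{ contains a }\Gamma\text{-conflict-free Hamilton cycle}]\ge1-\xi_n,$$ where the probability is over the independent edge retention, with $G,H,\Gamma$ fixed. The sequence $\xi_n$ is independent of the choices of $G,H,\Gamma$ and of $p,t$.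
   Context: Graphs are finite and simple; $\delta,\Delta$ denote minimum and maximum degree. For a graph $H$ and $t\in[0,1]$, $H_t$ is the random spanning subgraph of $H$ obtained by retaining every edge independently with probability $t$. For $A,B\subseteq V(G)$ (not necessarily disjoint), $e_G(A,B)$ is the number of ordered pairs $(a,b)\in A\times B$ with $ab\in E(G)$. A graph $G$ is $(p,\beta)$-bijumbled if $\bigl|e_G(A,B)-p|A||B|\bigr|\le\beta\sqrt{|A||B|}$ for all $A,B\subseteq V(G)$. A tuple $(n,p,G,\beta,H,\Gamma)$ is called eligible (with respect to $\varepsilon,c,\mu,M,n_0$) if: $n\ge n_0$, $p\in(0,1]$, $pn\ge M$; $G$ is an $n$-vertex $(p,\beta)$-bijumbled graph with $\beta\le cpn$; $H$ is a spanning subgraph of $G$ such that either (absolute alternative) $\delta(H)\ge(\tfrac12+\varepsilon)pn$, or (relative alternative) $\deg_H(v)\ge(\tfrac12+\varepsilon)\deg_G(v)$ for every $v\in V(G)$ and $\delta(G)\ge(1-\varepsilon/4)pn$; and $\Gamma$ is a conflict graph on $E(H)$, i.e. a graph with vertex set $E(H)$, satisfying $\Delta(\Gamma)\le\mu pn$. A subgraph of $H$ is $\Gamma$-conflict-free if its edge set is an independent set in $\Gamma$. For a nonempty family $\mathcal F$ of subgraphs of a fixed graph $H$, a probability measure $\nu$ on $\mathcal F$ is $q$-spread if $\nu[\{F\in\mathcal F:S\subseteq E(F)\}]\le q^{|S|}$ for every $S\subseteq E(H)$. *)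

(* Defs.v *)
From HB Require Import structures.
From mathcomp Require Import all_boot all_order all_algebra.
From mathcomp Require Import reals.

Set Implicit Arguments.
Unset Strict Implicit.
Unset Printing Implicit Defensive.

Import Order.TTheory GRing.Theory Num.Theory.

Local Open Scope ring_scope.

(* A finite simple graph on V is its edge set, a set of 2-element subsets of V.
   Graphs on V thus form a finite type, and a spanning subgraph of H is a graph
   on the same V whose edge set is included in that of H. *)
Record sgraph (V : finType) := SGraph {
  edges : {set {set V}};
  edgesP : [forall e in edges, #|e| == 2%N]
}.

HB.instance Definition _ (V : finType) := [isSub for @edges V].
HB.instance Definition _ (V : finType) := [Finite of sgraph V by <:].

Section Graphs.
Variable V : finType.
Implicit Types (G H F C : sgraph V) (A B S : {set V}).

Definition adj G (x y : V) : bool := [set x; y] \in edges G.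

Definition deg G (x : V) : nat := #|[set y | adj G x y]|.

Definition maxdeg G : nat := \max_(x : V) deg G x.

(* Degrees are less than #|V|, so the initial value does not affect the minimum
   when V is nonempty. *)
Definition mindeg G : nat := \big[minn/#|V|]_(x : V) deg G x.

Definition subgraph F H : bool := edges F \subset edges H.

Definition independent G S : bool :=
  [forall x in S, forall y in S, ~~ adj G x y].

Definition e_count G A B : nat :=
  #|[set ab in setX A B | adj G ab.1 ab.2]|.

(* A repetition-free s of length #|V| lists all the vertices in cyclic order. *)
Definition hamilton_cycle C : bool :=
  (3 <= #|V|)%N &&
  [exists s : #|V|.-tuple V,
     uniq s && (edges C == [set [set x; next s x] | x : V])].

End Graphs.

Definition bijumbled (R : realType) (V : finType) (p beta : R) (G : sgraph V) :
    Prop :=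
  forall A B : {set V},
    `| (e_count G A B)%:R - p * #|A|%:R * #|B|%:R |
      <= beta * Num.sqrt (#|A|%:R * #|B|%:R).

Definition conflict_graph (V : finType) (H : sgraph V) : Type :=
  sgraph {e : {set V} | e \in edges H}.

Definition conflict_free (V : finType) (H : sgraph V) (Gamma : conflict_graph H)
    (F : sgraph V) : bool :=
  independent Gamma [set e | val e \in edges F].

Definition cf_hamilton_cycles (V : finType) (H : sgraph V)
    (Gamma : conflict_graph H) : {set sgraph V} :=
  [set C | [&& hamilton_cycle C, subgraph C H & conflict_free Gamma C]].

Definition eligible (R : realType) (eps c mu M : R) (n0 : int)
    (n : nat) (V : finType) (p : R) (G : sgraph V) (beta : R) (H : sgraph V)
    (Gamma : conflict_graph H) : Prop :=
  [/\ [/\ n0 <= n%:Z, 0 < p <= 1 & M <= p * n%:R],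
      [/\ #|V| = n, bijumbled p beta G & beta <= c * p * n%:R],
      subgraph H G,
      ((1 / 2 + eps) * p * n%:R <= (mindeg H)%:R
       \/ (forall v : V, (1 / 2 + eps) * (deg G v)%:R <= (deg H v)%:R)
          /\ (1 - eps / 4) * p * n%:R <= (mindeg G)%:R)
    & (maxdeg Gamma)%:R <= mu * p * n%:R].

Definition prob_measure_on (R : realType) (V : finType) (FF : {set sgraph V})
    (nu : sgraph V -> R) : Prop :=
  [/\ forall F, 0 <= nu F,
      forall F, F \notin FF -> nu F = 0
    & \sum_(F in FF) nu F = 1].

Definition spread (R : realType) (V : finType) (H : sgraph V)
    (FF : {set sgraph V}) (q : R) (nu : sgraph V -> R) : Prop :=
  forall S : {set {set V}}, S \subset edges H ->
    \sum_(F in FF | S \subset edges F) nu F <= q ^+ #|S|.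

(* The probability that the random subgraph H_t satisfies Q: each edge of H is
   independently kept with probability t. *)
Definition prob_retained (R : realType) (V : finType) (H : sgraph V) (t : R)
    (Q : pred (sgraph V)) : R :=
  \sum_(F : sgraph V | subgraph F H && Q F)
    \prod_(e in edges H) (if e \in edges F then t else 1 - t).

Definition has_cf_hamilton_cycle (V : finType) (H : sgraph V)
    (Gamma : conflict_graph H) (F : sgraph V) : bool :=
  [exists C in cf_hamilton_cycles Gamma, subgraph C F].

(* Main.v *)
Require Import Defs.
From HB Require Import structures.
From mathcomp Require Import all_boot all_order all_algebra.
From mathcomp Require Import reals ring lra.

(* Spread implies threshold, by minimal fragments (Frankston-Kahn-Narayanan-Park,
   Park-Pham). Given a q-spread weighted family of sets S_i and a random set W, let
   the fragment of S_i be a difference S_j \ W of least size among the members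
   S_j contained in S_i U W. Fragments are contained in S_i, so they form again a
   q-spread family, and a further random set that contains a fragment completes W to
   a superset of a member. If Z is the union of W and a fragment A, then A lies in
   every member contained in Z; so Z leaves at most 2^r choices for A when members have
   size at most r. Exchanging W for Z costs a^-|A| at density a, and spreadness gives
   weight at most q^|A| to the members with fragment A, so the expected weight of the
   members with a fragment of size at least m is at most 2^r (q/a)^m. Rounds of density
   16q halve the sizes from n down to 2^j0, and a last round of density q log n
   empties the sets. *)

Set Implicit Arguments.
Unset Strict Implicit.
Unset Printing Implicit Defensive.

Import Order.TTheory GRing.Theory Num.Theory.

Local Open Scope ring_scope.

(** * Random subsets of a finite set with independent elements *)

Section RandomSubset.
Variables (R : realFieldType) (X : finType).
Implicit Types (W A Z : {set X}) (a b t : R) (f g : {set X} -> R).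

Definition weight t W : R := \prod_(x : X) (if x \in W then t else 1 - t).

Definition expect t f : R := \sum_(W : {set X}) weight t W * f W.

Lemma weight_ge0 t W : 0 <= t <= 1 -> 0 <= weight t W.
Proof.
by move=> t01; apply: prodr_ge0 => x _; case: ifP => _; lra.
Qed.

Lemma sum_weight t : \sum_(W : {set X}) weight t W = 1.
Proof.
transitivity (\prod_(x : X) (t + (1 - t))); first by rewrite bigA_distr.
by rewrite big1 // => x _; ring.
Qed.

Lemma ler_expect t f g :
  0 <= t <= 1 -> (forall W, f W <= g W) -> expect t f <= expect t g.
Proof.
by move=> t01 fg; apply: ler_sum => W _; apply: ler_wpM2l => //; apply: weight_ge0.
Qed.

Lemma expectD t f g : expect t (fun W => f W + g W) = expect t f + expect t g.
Proof. by rewrite -big_split; apply: eq_bigr => W _; rewrite mulrDr. Qed.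

Lemma expectZ t c f : expect t (fun W => c * f W) = c * expect t f.
Proof. by rewrite mulr_sumr; apply: eq_bigr => W _; rewrite mulrCA. Qed.

Lemma expect_const t c : expect t (fun=> c) = c.
Proof. by rewrite /expect -mulr_suml sum_weight mul1r. Qed.

(** The union of two independent random sets is again one: an element belongs to it with probability
    [a + (1 - a) * b], independently of the others. Both sides are compared at each value [Z] of the
    union, where the weights factor over single elements. *)
Lemma expect_setU a b f :
  expect a (fun W => expect b (fun W' => f (W :|: W'))) = expect (a + b - a * b) f.
Proof.
have indicE W Z : \prod_x ((x \in W) == (x \in Z))%:R = (W == Z)%:R :> R.
  case: eqP => [->|/eqP neqWZ]; first by rewrite big1 // => x _; rewrite eqxx.
  have /forallPn[x /negPf nx] : ~~ [forall x, (x \in W) == (x \in Z)].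
    by apply: contra neqWZ => /forallP eqWZ; apply/eqP/setP => x; apply/eqP.
  by rewrite (bigD1 x) //= nx mul0r.
have splitZ W : expect b (fun W' => f (W :|: W')) =
    \sum_Z f Z * \sum_W' weight b W' * ((W :|: W') == Z)%:R.
  under [RHS]eq_bigr do rewrite mulr_sumr.
  rewrite exchange_big; apply: eq_bigr => W' _.
  rewrite (bigD1 (W :|: W')) //= eqxx mulr1 big1 ?addr0 1?mulrC // => Z.
  by rewrite eq_sym => /negPf ->; rewrite !mulr0.
have weightU W Z : \sum_W' weight b W' * ((W :|: W') == Z)%:R =
    \prod_x (b * (x \in Z)%:R + (1 - b) * ((x \in W) == (x \in Z))%:R).
  rewrite bigA_distr; apply: eq_bigr => W' _.
  rewrite -indicE -big_split; apply: eq_bigr => x _ /=.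
  by rewrite inE; case: (x \in W'); rewrite ?orbT ?orbF.
rewrite /expect.
under eq_bigr => W _ do rewrite -/(expect b _) splitZ mulr_sumr.
rewrite exchange_big; apply: eq_bigr => Z _ /=.
under eq_bigr => W _ do rewrite weightU mulrCA.
rewrite -mulr_sumr mulrC; congr (_ * _).
under eq_bigr => W _ do rewrite /weight -big_split /=.
transitivity (\prod_x (a * (x \in Z)%:R +
    (1 - a) * (b * (x \in Z)%:R + (1 - b) * (x \notin Z)%:R))).
  rewrite bigA_distr; apply: eq_bigr => W _; apply: eq_bigr => x _.
  by case: (x \in W); case: (x \in Z) => //=; ring.
by apply: eq_bigr => x _; case: (x \in Z) => /=; ring.
Qed.

(** Coupling: a set of density [t] is a set of density [s] joined with an independent set of density
    [b = (t - s) / (1 - s)], and enlarging the set cannot increase [f]. *)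
Lemma expect_antitone s t f :
  0 <= s -> s <= t <= 1 -> (forall W W', f (W :|: W') <= f W) ->
  expect t f <= expect s f.
Proof.
move=> s0 /andP[st t1] fU.
have [s1|s1] := eqVneq s 1; first by have -> : t = s by lra.
have s1' : 0 < 1 - s by rewrite subr_gt0 lt_neqAle s1 (le_trans st).
pose b := (t - s) / (1 - s).
have b01 : 0 <= b <= 1 by rewrite divr_ge0 ?ler_pdivrMr //; lra.
have -> : t = s + b - s * b by rewrite /b; field; rewrite gt_eqF.
rewrite -expect_setU; apply: ler_expect => [|W]; first lra.
by rewrite -[leRHS](expect_const b); apply: ler_expect.
Qed.

(** Adding an element of [A] to [W] replaces a factor [1 - t] by [t], and [(1 - t) * t <= t]. *)
Lemma weight_setU t W A :
  0 <= t <= 1 -> [disjoint W & A] -> weight t W * t ^+ #|A| <= weight t (W :|: A).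
Proof.
move=> t01 disWA; rewrite -prodr_const big_mkcond -big_split /=.
apply: ler_prod => x _; rewrite !inE.
case: (boolP (x \in W)) => [xW|_]; first by rewrite (disjointFr disWA xW) /=; nra.
by case: (x \in A) => /=; nra.
Qed.

End RandomSubset.

(** * Minimal fragments of a spread family *)

Section Fragments.
Variables (R : realFieldType) (X I : finType) (nu : I -> R) (q : R).
Hypothesis nu_ge0 : forall i, 0 <= nu i.
Hypothesis q_gt0 : 0 < q.
Implicit Types (P : {set I}) (S : I -> {set X}) (W A Z : {set X}).

Definition covered P S W := [exists i in P, S i \subset W].

Definition spread_family P S :=
  forall A, \sum_(i in P | A \subset S i) nu i <= q ^+ #|A|.

(** The default [i] meets the condition of the arg min whenever [i \in P]. Minimizers need not be
    unique; selecting one makes the fragment a function of [W] and [i]. *)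
Definition fragment P S W i : {set X} :=
  S [arg min_(j < i | (j \in P) && (S j \subset S i :|: W)) #|S j :\: W|] :\: W.

Lemma fragmentP P S W i : i \in P ->
  exists2 j, (j \in P) && (S j \subset S i :|: W) &
    fragment P S W i = S j :\: W /\
    forall k, k \in P -> S k \subset S i :|: W ->
      (#|fragment P S W i| <= #|S k :\: W|)%N.
Proof.
move=> iP; rewrite /fragment; case: arg_minnP => [|j Pj jmin].
  by rewrite iP subsetUl.
by exists j => //; split=> // k kP kS; apply: jmin; rewrite kP.
Qed.

Lemma fragment_sub P S W i : i \in P -> fragment P S W i \subset S i.
Proof.
by case/(@fragmentP _ S W) => j /andP[_ jS] [-> _]; rewrite subDset setUC.
Qed.

Lemma disjoint_fragment P S W i : [disjoint W & fragment P S W i].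
Proof. by rewrite disjoint_sym disjoints_subset subsetDr. Qed.

Lemma fragment_covered P S W i : i \in P -> covered P S (W :|: fragment P S W i).
Proof.
case/(@fragmentP _ S W) => j /andP[jP _] [-> _]; apply/existsP; exists j.
by rewrite jP /= -subDset.
Qed.

(* The union of [W] and the fragment determines the fragment up to the choice of
   a subset of any one member that the union contains. *)
Lemma fragment_sub_covered P S W i k : i \in P -> k \in P ->
  S k \subset W :|: fragment P S W i -> fragment P S W i \subset S k.
Proof.
move=> iP kP kS; have [j _ [_ /(_ k kP)]] := @fragmentP P S W i iP.
have -> : S k \subset S i :|: W.
  by apply: subset_trans kS _; rewrite setUC setSU // fragment_sub.
move=> /(_ isT) le_card; have /eqP <- : S k :\: W == fragment P S W i.
  by rewrite eqEcard le_card subDset kS.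
exact: subsetDl.
Qed.

Lemma spread_fragment P S W P' :
  P' \subset P -> spread_family P S -> spread_family P' (fragment P S W).
Proof.
move=> /subsetP sP'P spr A; apply: le_trans (spr A).
rewrite big_mkcond [leRHS]big_mkcond; apply: ler_sum => i _.
case: ifP => [/andP[/sP'P iP Ai]|_]; last by case: ifP.
by rewrite iP (subset_trans Ai) // fragment_sub.
Qed.

Lemma expect_large_fragment P S (r m : nat) (a : R) :
  spread_family P S -> (forall i, i \in P -> #|S i| <= r)%N -> q <= a <= 1 ->
  expect a (fun W => \sum_(i in P | (m <= #|fragment P S W i|)%N) nu i) <=
    2 ^+ r * (q / a) ^+ m.
Proof.
move=> spr Sr /andP[qa a1].
have a0 : 0 < a by apply: lt_le_trans qa.
have a01 : 0 <= a <= 1 by rewrite ltW.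
have qa0 : 0 <= q / a by rewrite divr_ge0 // ltW.
pose isfrag W A := [exists i in P, fragment P S W i == A].
(* Group the members by their fragment [A]. Spreadness bounds each class by
   [q ^+ #|A| = a ^+ #|A| * (q / a) ^+ #|A|], and the power of [a] pays for passing from [W] to
   [W :|: A]. *)
have boundW W : weight a W * \sum_(i in P | (m <= #|fragment P S W i|)%N) nu i <=
    \sum_(A | isfrag W A) weight a (W :|: A) * (q / a) ^+ m.
  rewrite (partition_big (fragment P S W) (fun A => isfrag W A && (m <= #|A|)%N)) /=; last first.
    move=> i /andP[iP mi]; rewrite mi andbT; apply/existsP; exists i.
    by rewrite iP eqxx.
  rewrite mulr_sumr big_mkcondr; apply: ler_sum => A /existsP[i /andP[iP /eqP fA]].
  case: ifP => [mA|_]; last by rewrite mulr_ge0 ?weight_ge0 ?exprn_ge0.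
  apply: (@le_trans _ _ (weight a W * q ^+ #|A|)).
    rewrite ler_wpM2l ?weight_ge0 //; apply: le_trans (spr A).
    rewrite big_mkcond [leRHS]big_mkcond; apply: ler_sum => k _.
    case: ifP => [/andP[/andP[kP _] /eqP <-]|_]; last by case: ifP.
    by rewrite kP fragment_sub.
  have -> : q ^+ #|A| = a ^+ #|A| * (q / a) ^+ #|A|.
    by rewrite -exprMn mulrCA mulfV ?gt_eqF // mulr1.
  rewrite mulrA ler_pM ?mulr_ge0 ?weight_ge0 ?exprn_ge0 ?(ltW a0) //.
    by rewrite weight_setU // -fA disjoint_fragment.
  by rewrite ler_wiXn2l // ler_pdivrMr // mul1r.
apply: le_trans (ler_sum _ (fun W _ => boundW W)) _.
rewrite (exchange_big_dep xpredT) //=.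
have unDE A Z : ((Z :\: A) :|: A == Z) = (A \subset Z).
  apply/eqP/idP => [<-|]; first exact: subsetUr.
  by move/setUidPl => AZ; rewrite setDE setUIl AZ [_ :|: A]setUC setUCr setIT.
(* A fragment is disjoint from [W], so [W] is recovered from [Z = W :|: A] as [Z :\: A]. *)
have reindexA A : \sum_(W | isfrag W A) weight a (W :|: A) * (q / a) ^+ m =
    \sum_(Z | isfrag (Z :\: A) A && (A \subset Z)) weight a Z * (q / a) ^+ m.
  rewrite (reindex_onto (fun Z => Z :\: A) (fun W => W :|: A)) /=; last first.
    move=> W /existsP[i /andP[iP /eqP <-]].
    rewrite setDUl setDv setU0; apply/setDidPl; exact: disjoint_fragment.
  apply: eq_big => Z; first by rewrite unDE.
  by case/andP => _ /eqP ->.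
under eq_bigr => A _ do rewrite reindexA.
rewrite (exchange_big_dep xpredT) //=.
(* The weights of all [Z] sum to 1, so it remains to count the possible [A] for each fixed [Z]. *)
rewrite -[leRHS]mulr1 -[Y in _ <= _ * Y](sum_weight X a) mulr_sumr; apply: ler_sum => Z _.
rewrite sumr_const -[leLHS]mulr_natl -mulrA [weight _ _ * _]mulrC mulrA mulrCA mulrA.
rewrite ler_wpM2r ?weight_ge0 // [leRHS]mulrC ler_wpM2l ?exprn_ge0 // -natrX ler_nat.
have ZE A : A \subset Z -> (Z :\: A) :|: A = Z by rewrite -unDE => /eqP.
(* If [Z] contains a member [S k], every such [A] is a subset of [S k]. If it contains none, there
   is no such [A], because [W] together with a fragment always contains a member. *)
have [/existsP[k /andP[kP kZ]]|ncov] := boolP (covered P S Z).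
  apply: (@leq_trans #|powerset (S k)|); last first.
    by rewrite card_powerset leq_pexp2l // Sr.
  apply/subset_leq_card/subsetP => A.
  rewrite [in X in X -> _]unfold_in powersetE => /andP[/existsP[i /andP[iP /eqP fA]] AZ].
  by rewrite -fA (fragment_sub_covered iP kP) // fA ZE.
rewrite eq_card0 // => A; apply/negbTE; apply: contra ncov.
rewrite [in X in X -> _]unfold_in => /andP[/existsP[i /andP[iP /eqP fA]] AZ].
by rewrite -(ZE _ AZ) -{2}fA; apply: fragment_covered.
Qed.

(* [s] is the density and [d] the failure probability, scaled by the total mass. *)
Definition failure_bound (r : nat) (s d : R) :=
  forall P S, spread_family P S -> (forall i, i \in P -> #|S i| < r)%N ->
  (\sum_(i in P) nu i) * expect s (fun W => (~~ covered P S W)%:R) <= d.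

Lemma failure_bound1 : failure_bound 1 0 0.
Proof.
move=> P S _ S0; have [->|[i iP]] := set_0Vmem P; first by rewrite big_set0 mul0r.
suff cov W : covered P S W by rewrite [expect _ _]big1 ?mulr0 // => W _; rewrite cov mulr0.
apply/existsP; exists i; rewrite iP /=.
by move: (S0 i iP); rewrite ltnS leqn0 cards_eq0 => /eqP ->; rewrite sub0set.
Qed.

(** Expose [W] at density [a]. Members with a fragment of size at least [m] are charged to
    [expect_large_fragment]; the other fragments form a spread family, to which the hypothesis
    applies at density [s]. The mass of that family varies with [W], and scaling by mass lets [d]
    serve for every [W]. *)
Lemma failure_bound_step (m r : nat) (a s d : R) :
  failure_bound m s d -> q <= a <= 1 -> 0 <= s <= 1 ->
  failure_bound r (a + s - a * s) (d + 2 ^+ r * (q / a) ^+ m).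
Proof.
move=> bnd qa1 s01 P S spr Sr.
have a01 : 0 <= a <= 1 by move: qa1 (ltW q_gt0) => /andP[? ->] ?; rewrite (@le_trans _ _ q).
have Sr' i : i \in P -> (#|S i| <= r)%N by move=> iP; apply/ltnW/Sr.
have large := expect_large_fragment m spr Sr' qa1.
rewrite -expect_setU -expectZ addrC.
apply: le_trans (lerD large (lexx d)).
rewrite -[d in leRHS](expect_const X a) -expectD; apply: ler_expect => // W.
set P' := [set i in P | (#|fragment P S W i| < m)%N].
have P'P : P' \subset P by apply/subsetP => i; rewrite inE => /andP[].
rewrite (bigID (fun i => (m <= #|fragment P S W i|)%N)) /= mulrDl lerD //.
  rewrite -[leRHS]mulr1 ler_wpM2l ?sumr_ge0 //.
  rewrite -[leRHS](expect_const X s); apply: ler_expect => // W'.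
  by case: covered.
apply: le_trans (bnd P' (fragment P S W) _ _); last 2 first.
- exact: spread_fragment.
- by move=> i; rewrite inE => /andP[].
rewrite [X in X * _ <= _](_ : _ = \sum_(i in P') nu i); last first.
  by apply: eq_bigl => i; rewrite inE -ltnNge.
rewrite ler_wpM2l ?sumr_ge0 //; apply: ler_expect => // W'.
rewrite ler_nat; case: (boolP (covered P' _ W')) => [/existsP[i /andP[iP' iW']]|_].
  suff -> : covered P S (W :|: W') by [].
  have iP : i \in P by apply: (subsetP P'P).
  have [j /andP[jP _] [fj _]] := @fragmentP P S W i iP.
  by apply/existsP; exists j; rewrite jP -subDset -fj.
by case: covered.
Qed.

(* Densities [J q] for the last round (sizes below [2 ^ j0]) and [16 q] for each of
   the [k] halving rounds before it. *)
Lemma failure_bound_iter (J j0 k : nat) :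
  (0 < J)%N -> (16 * k + J)%:R * q <= 1 ->
  exists2 s : R, 0 <= s <= (16 * k + J)%:R * q &
    failure_bound (2 ^ (j0 + k)) s
      (2 ^+ (2 ^ j0) / J%:R + (1 / 2) ^+ j0 - (1 / 2) ^+ (j0 + k)).
Proof.
move=> J0; have J1 : 1 <= J%:R :> R by rewrite ler1n.
elim: k => [|k IHk] le1.
  exists (J%:R * q); first by rewrite muln0 add0n lexx mulr_ge0 // ltW.
  rewrite muln0 add0n in le1.
  (* Last round: [m = 1] leaves only empty fragments, and density [J q] makes the loss
     [2 ^ 2 ^ j0 / J]. *)
  have := @failure_bound_step 1 (2 ^ j0) (J%:R * q) 0 0 failure_bound1.
  rewrite le1 ler_peMl ?(ltW q_gt0) // lexx ler01 addr0 mulr0 subr0 add0r expr1.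
  have -> : q / (J%:R * q) = J%:R^-1 by field; rewrite !gt_eqF // (lt_le_trans ltr01).
  by rewrite addn0 addrK; apply.
have e1 : (16 * k.+1 + J)%:R * q = (16 * k + J)%:R * q + 16 * q :> R.
  by rewrite !natrD !natrM -natr1; ring.
have /IHk[s /andP[s0 sk] bnd] : (16 * k + J)%:R * q <= 1.
  by move: le1 q_gt0; rewrite e1; lra.
exists (16 * q + s - 16 * q * s).
  rewrite e1; move: le1 q_gt0; rewrite e1 => le1 q0; nra.
have q16 : q <= 16 * q <= 1.
  have : 0 <= (16 * k + J)%:R * q by rewrite mulr_ge0 // ltW.
  by move: le1 q_gt0; rewrite e1; lra.
have s01 : 0 <= s <= 1 by move: le1 q_gt0; rewrite e1; lra.
have bnd' := failure_bound_step bnd q16 s01.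
move=> P S spr Sr; apply: le_trans (bnd' _ P S spr Sr) _.
(* With [m = 2 ^ (j0 + k)] this round loses [2 ^ (2m) / 16 ^ m = (1 / 2) ^ (2m)]. This is at most
   [(1 / 2) ^ (j0 + k).+1], exactly the growth of the claimed bound from [k] to [k.+1]. *)
have -> : q / (16 * q) = (1 / 2) ^+ 4 by field; rewrite gt_eqF.
rewrite -exprM addnS expnS.
have -> : 2 ^+ (2 * 2 ^ (j0 + k)) * (1 / 2) ^+ (4 * 2 ^ (j0 + k)) =
    (1 / 2) ^+ (2 * 2 ^ (j0 + k)) :> R.
  rewrite (_ : 4 * _ = 2 * 2 ^ (j0 + k) + 2 * 2 ^ (j0 + k))%N; last by rewrite -mulnDl.
  by rewrite exprD mulrA -exprMn (_ : 2 * (1 / 2) = 1 :> R) ?expr1n ?mul1r //; field.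
have : (1 / 2) ^+ (2 * 2 ^ (j0 + k)) <= (1 / 2) ^+ (j0 + k).+1 :> R.
  rewrite ler_wiXn2l //; try lra.
  by rewrite (leq_trans (ltn_expl _ (isT : 1 < 2)%N)) // leq_pmull.
have -> : (1 / 2) ^+ (j0 + k) = 2 * (1 / 2) ^+ (j0 + k).+1 :> R.
  by rewrite exprS mulrA; field.
lra.
Qed.

(** Run [J - j0] halving rounds from size [2 ^ J], then the last round. The total density is at most
    [(16 J + J) q = 17 J q], and monotonicity carries the bound up to [t]. *)
Lemma covered_spread_family P S (J j0 : nat) (t : R) :
  spread_family P S -> \sum_(i in P) nu i = 1 ->
  (forall i, i \in P -> #|S i| < 2 ^ J)%N -> (0 < J)%N -> (j0 <= J)%N ->
  17 * J%:R * q <= t <= 1 ->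
  1 - (2 ^+ (2 ^ j0) / J%:R + (1 / 2) ^+ j0) <=
    expect t (fun W => (covered P S W)%:R).
Proof.
move=> spr nu1 SJ J0 j0J /andP[tJ t1].
have le17 : (16 * (J - j0) + J)%:R * q <= t.
  apply: le_trans tJ; rewrite ler_pM2r // -natrM ler_nat.
  by rewrite (mulSn 16) addnC leq_add2l leq_mul2l leq_subr orbT.
have [s /andP[s0 sle] bnd] := failure_bound_iter j0 J0 (le_trans le17 t1).
have fail_le : expect t (fun W => (~~ covered P S W)%:R) <=
    2 ^+ (2 ^ j0) / J%:R + (1 / 2) ^+ j0.
  apply: (@le_trans _ _ (expect s (fun W => (~~ covered P S W)%:R))).
    apply: expect_antitone => // [|W W'].
      by rewrite t1 (le_trans sle).
    rewrite ler_nat; case: (boolP (covered P S W)) => [/existsP[i /andP[iP iW]]|_].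
      suff -> : covered P S (W :|: W') by [].
      by apply/existsP; exists i; rewrite iP (subset_trans iW) // subsetUl.
    by case: covered.
  have := bnd P S spr; rewrite nu1 mul1r subnKC // => /(_ SJ) h.
  by apply: le_trans h _; rewrite gerBl exprn_ge0 // divr_ge0.
rewrite lerBlDr -{1}(expect_const X t 1).
rewrite (_ : expect t (fun=> 1) = expect t (fun W => (covered P S W)%:R) +
  expect t (fun W => (~~ covered P S W)%:R)); first by rewrite lerD2l.
rewrite -expectD; apply: eq_bigr => W _; congr (_ * _).
by case: covered => /=; ring.
Qed.

End Fragments.

(** * Spanning subgraphs of [H] as subsets of its edge type *)

Section RetainedEdges.
Variables (R : realType) (V : finType) (H : sgraph V).
Local Notation edge := {e : {set V} | e \in edges H}.
Implicit Types (F : sgraph V) (W A : {set edge}).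

(** The ground type consists of the edges of [H] alone, so that its subsets correspond to the
    spanning subgraphs of [H]; edges of [F] outside [H] are dropped. *)
Definition edge_set F : {set edge} := [set x | val x \in edges F].

Lemma graph_of_subproof W : [forall e in [set val x | x in W], #|e| == 2%N].
Proof.
apply/forall_inP => _ /imsetP[x _ ->].
exact: (forall_inP (edgesP H) _ (valP x)).
Qed.

Definition graph_of W : sgraph V := SGraph (graph_of_subproof W).

Lemma edge_setK F : subgraph F H -> graph_of (edge_set F) = F.
Proof.
move=> /subsetP FH; apply: val_inj => /=; apply/setP => e.
apply/imsetP/idP => [[x + ->]|eF]; first by rewrite inE.
by exists (Sub e (FH e eF)); rewrite ?inE SubK.
Qed.

Lemma graph_ofK W : edge_set (graph_of W) = W.
Proof. by apply/setP => x; rewrite inE /= mem_imset //; apply: val_inj. Qed.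

Lemma subgraph_graph_of W : subgraph (graph_of W) H.
Proof. by apply/subsetP => _ /imsetP[x _ ->]; apply: valP. Qed.

Lemma subset_edge_set F A : (A \subset edge_set F) = (val @: A \subset edges F).
Proof.
apply/subsetP/subsetP => [AF _ /imsetP[x /AF + ->]|AF x xA]; first by rewrite inE.
by rewrite inE AF // imset_f.
Qed.

Lemma subgraphE F F' : subgraph F H -> subgraph F F' = (edge_set F \subset edge_set F').
Proof. by move=> FH; rewrite subset_edge_set -[val @: _]/(edges (graph_of _)) edge_setK. Qed.

Lemma card_edge_set F : (#|edge_set F| <= #|edges F|)%N.
Proof.
rewrite -(card_imset _ val_inj); apply/subset_leq_card.
by rewrite -subset_edge_set.
Qed.

Lemma prob_retainedE (t : R) (Q : pred (sgraph V)) :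
  prob_retained H t Q = expect t (fun W => (Q (graph_of W))%:R).
Proof.
rewrite /prob_retained (reindex_onto graph_of edge_set) /=; last first.
  by move=> F /andP[FH _]; apply: edge_setK.
rewrite big_mkcond; apply: eq_bigr => W _.
rewrite subgraph_graph_of graph_ofK eqxx andbT /=.
case: (Q _); rewrite ?mulr0 // mulr1 big_sub.
by apply: eq_bigr => x _; rewrite mem_imset //; apply: val_inj.
Qed.

Lemma spread_edge_set (FF : {set sgraph V}) (q : R) (nu : sgraph V -> R) :
  spread H FF q nu -> spread_family nu q FF edge_set.
Proof.
move=> spr A; rewrite -(card_imset A val_inj).
under eq_bigl do rewrite subset_edge_set.
by apply: spr; apply/subsetP => _ /imsetP[x _ ->]; apply: valP.
Qed.

Lemma has_cf_hamilton_cycleE (Gamma : conflict_graph H) W :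
  has_cf_hamilton_cycle Gamma (graph_of W) =
  covered (cf_hamilton_cycles Gamma) edge_set W.
Proof.
apply: eq_existsb => C; case: (boolP (C \in _)) => //=.
by rewrite inE => /and3P[_ CH _]; rewrite subgraphE // graph_ofK.
Qed.

Lemma card_hamilton_cycle F : hamilton_cycle F -> (#|edges F| <= #|V|)%N.
Proof.
by case/andP => _ /existsP[s /andP[_ /eqP ->]]; apply: leq_imset_card.
Qed.

End RetainedEdges.

(** * Numerical estimates and the final choice of parameters *)

Lemma iterated_exp_bound (R : realFieldType) (J k : nat) :
  (2 ^ 2 ^ k.+1 <= J)%N -> 2 ^+ (2 ^ k) / J%:R <= (1 / 2) ^+ k :> R.
Proof.
move=> kJ; have J0 : 0 < J%:R :> R by rewrite ltr0n (leq_trans _ kJ) // expn_gt0.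
rewrite ler_pdivrMr // (le_trans _ (ler_wpM2l _ (_ : (2 ^ 2 ^ k.+1)%:R <= _))) //;
  last 2 first.
- by rewrite exprn_ge0 // divr_ge0.
- by rewrite ler_nat.
(* [2 ^ 2 ^ k.+1] is the square of [2 ^ 2 ^ k]: one factor cancels the numerator, the other is at
   least [2 ^ k]. *)
rewrite expnS mulSn mul1n expnD natrM !natrX mulrA ler_peMl ?exprn_ge0 //.
rewrite div1r exprVn mulrC ler_pdivlMr ?exprn_gt0 // mul1r ler_weXn2l ?ler1n //.
by apply/ltnW/ltn_expl.
Qed.

(* Imported only now, since [classical_sets] shadows lemmas of [finset]. *)
From mathcomp Require Import all_classical all_reals all_analysis.
Import numFieldNormedType.Exports.

Local Open Scope classical_set_scope.

Lemma cvg_trunc_log (p : nat) : (1 < p)%N -> trunc_log p n @[n --> \oo] --> \oo.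
Proof.
move=> p1; apply/cvgnyPge => A; exists (p ^ A)%N => // n /= An.
exact: trunc_log_max.
Qed.

Lemma succ_trunc_log2_le_ln (R : realType) (n : nat) :
  (1 < n)%N -> (trunc_log 2 n).+1%:R <= 4 * ln n%:R :> R.
Proof.
move=> n1; have n0 : (0 < n)%N by apply: ltnW.
(* From [ln (1 + x) <= x] at [x = - (1 / 2)]. The constant 4 then comes from [l + 1 <= 2 * l] and
   [l * ln 2 <= ln n], where [l = trunc_log 2 n]. *)
have ln2 : 1 / 2 <= ln 2 :> R.
  have := @le_ln1Dx R (- (1 / 2)).
  rewrite (_ : 1 + _ = 2^-1); last by field.
  by rewrite lnV ?posrE // => /(_ _); lra.
have l1 : 1 <= (trunc_log 2 n)%:R :> R by rewrite ler1n trunc_log_gt0.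
have : (trunc_log 2 n)%:R * ln 2 <= ln n%:R :> R.
  rewrite mulr_natl -lnXn // ler_ln ?posrE ?exprn_gt0 ?ltr0n //.
  by rewrite -natrX ler_nat trunc_logP.
by rewrite -natr1; nra.
Qed.

Theorem corollary1p12 (R : realType) :
  exists D : R -> R,
  forall (eps c mu L M : R) (n0 : int),
    0 < eps < 1 / 2 -> 0 < c -> 0 < mu -> 0 < L -> 0 < M ->
    (forall (n : nat) (V : finType) (p : R) (G : sgraph V) (beta : R)
            (H : sgraph V) (Gamma : conflict_graph H),
        eligible eps c mu M n0 n p G beta Gamma ->
        exists nu : sgraph V -> R,
          prob_measure_on (cf_hamilton_cycles Gamma) nu /\
          spread H (cf_hamilton_cycles Gamma) (L / (p * n%:R)) nu) ->
    0 < D L /\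
    exists xi : nat -> R,
      xi n @[n --> \oo] --> (0 : R) /\
      \forall n \near \oo,
        forall (V : finType) (p : R) (G : sgraph V) (beta : R)
               (H : sgraph V) (Gamma : conflict_graph H) (t : R),
          eligible eps c mu M n0 n p G beta Gamma ->
          D L * ln n%:R / (p * n%:R) <= t <= 1 ->
          1 - xi n <= prob_retained H t (has_cf_hamilton_cycle Gamma).
Proof.
(* The rounds use total density 17 J q with q = L / (p n), and J n <= 4 ln n. *)
exists (fun L => 68 * L) => eps c mu L M n0 _ _ _ L0 _ spreadP.
split; first by rewrite mulr_gt0.
(* The successor gives [n < 2 ^ J n], a strict bound on the number of edges of a Hamilton cycle. *)
pose J n := (trunc_log 2 n).+1.
(* The largest [j0] with [(2 ^ 2 ^ j0) ^ 2 <= J n]. *)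
pose j0 n := (trunc_log 2 (trunc_log 2 (J n))).-1.
(* Each of the two error terms of [covered_spread_family] is at most [(1 / 2) ^+ j0 n]. *)
exists (fun n => 2 * (1 / 2) ^+ j0 n); split.
  rewrite -[0](mulr0 2); apply: cvgMr; apply: (@cvg_comp _ _ _ j0 (fun k => (1 / 2) ^+ k)).
    rewrite /j0; under eq_fun do rewrite -subn1.
    apply: (cvg_comp _ _ _ (cvg_subnr 1)).
    apply: (cvg_comp _ _ _ (cvg_trunc_log _)) => //.
    apply: (cvg_comp _ _ _ (cvg_trunc_log _)) => //.
    rewrite /J; under eq_fun do rewrite -addn1.
    by apply: (cvg_comp _ _ (cvg_trunc_log _) (cvg_addnr 1)).
  by apply: cvg_expr; rewrite ger0_norm; lra.
(* From [n >= 8] on, [J n >= 4], so the iterated logarithm in [j0] is at least 1 and its predecessor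
   is not truncated. *)
exists 8%N => // n /= n8 V p G beta H Gamma t elig /andP[Dt t1].
have n1 : (1 < n)%N by apply: leq_trans n8.
have [[_ /andP[p0 _] _] [cardV _ _] _ _ _] := elig.
have [nu [[nu0 _ nu1] spr]] := spreadP _ _ _ _ _ _ _ elig.
have pn0 : 0 < p * n%:R by rewrite mulr_gt0 // ltr0n ltnW.
have q0 : 0 < L / (p * n%:R) by apply: divr_gt0.
have J4 : (4 <= J n)%N by rewrite ltnS (@trunc_log_max 2 n 3).
have l2 : (2 <= trunc_log 2 (J n))%N by rewrite (@trunc_log_max 2 _ 2).
have l1 : (1 <= trunc_log 2 (trunc_log 2 (J n)))%N by rewrite (@trunc_log_max 2 _ 1).
have jJ : (2 ^ 2 ^ (j0 n).+1 <= J n)%N.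
  rewrite prednK //; apply: leq_trans (@trunc_logP 2 (J n) _ _) => //.
  by rewrite leq_exp2l // trunc_logP // ltnW.
have Jt : 17 * (J n)%:R * (L / (p * n%:R)) <= t <= 1.
  rewrite t1 andbT; apply: le_trans Dt; rewrite mulrA ler_pM2r ?invr_gt0 //.
  by have := succ_trunc_log2_le_ln R n1; rewrite -/(J n); nra.
have sizeJ C : C \in cf_hamilton_cycles Gamma -> (#|edge_set H C| < 2 ^ J n)%N.
  rewrite inE => /and3P[hamC _ _]; apply: leq_ltn_trans (card_edge_set H C) _.
  by apply: leq_ltn_trans (card_hamilton_cycle hamC) _; rewrite cardV trunc_log_ltn.
have j0J : (j0 n <= J n)%N.
  rewrite -ltnS ltnW //; apply: leq_trans (leq_trans jJ (leqnSn _)).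
  by rewrite (leq_ltn_trans _ (ltn_expl _ _)) // ltnW // ltn_expl.
have := covered_spread_family nu0 q0 (spread_edge_set spr) nu1 sizeJ _ j0J Jt.
rewrite prob_retainedE.
have -> : (fun W => (has_cf_hamilton_cycle Gamma (graph_of W))%:R) =
    (fun W => (covered (cf_hamilton_cycles Gamma) (@edge_set _ H) W)%:R) :> (_ -> R).
  by apply/funext => W; rewrite has_cf_hamilton_cycleE.
move=> /(_ isT); apply: le_trans; rewrite lerD2l lerN2 mulr_natl mulr2n.
by rewrite lerD2r iterated_exp_bound.
Qed.
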